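(* Let $M$ be a simple matroid on $[n]$ of rank $\ell\ge 3$. If the Orlik–Solomon algebra $A(M)=E/I(M)$ is quadratic, then $M$ is $3$-independent.
   Context: $R$ is an arbitrary nonzero commutative ring with $1$. A simple matroid has no loops and no nontrivial parallel classes; $[n]=\{1,\dots,n\}$. $E$ is the exterior algebra over $R$ on the free $R$-module with basis $e_1,\dots,e_n$, with the standard grading. For $S=\{i_1<\dots<i_p\}\subset[n]$ put $e_S=e_{i_1}\cdots e_{i_p}$ ($e_\emptyset=1$). $\partial:E\to E$ is the $R$-linear map of degree $-1$ with $\partial e_i=1$ for all $i$ and $\partial(ab)=(\partial a)b+(-1)^{\deg a}a\,\partial b$ for homogeneous $a$ and all $b$. The Orlik–Solomon ideal $I(M)$ is the (graded) ideal of $E$ generated by $\partial e_S$ for all dependent sets $S$ of $M$. $A(M)$ is quadratic if $I(M)$ is generated as an ideal by its degree $2$ component $I(M)\cap E_2$. For $3\le p\le \ell+1$, a partition $\pi$ of $[n]$ is $p$-independent if, whenever one chooses at most $p$ parts of $\pi$ and one element from each of them, the chosen elements form an independent set of $M$. A partition is independent if it is $(\ell+1)$-independent. For $3\le p\le\ell$, the matroid $M$ is $p$-independent if every $p$-independent partition of $[n]$ is independent. *)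

(* Defs.v *)
From HB Require Import structures.
From mathcomp Require Import all_boot all_order all_algebra.
From mathcomp Require Import zify.

Set Implicit Arguments.
Unset Strict Implicit.
Unset Printing Implicit Defensive.

Import GRing.Theory.
Local Open Scope ring_scope.

(** * Matroids *)

Record matroid (T : finType) := Matroid {
  indep : {set {set T}};
  indep0 : set0 \in indep;
  indepS : forall A B : {set T}, A \subset B -> B \in indep -> A \in indep;
  indep_augment : forall A B : {set T}, A \in indep -> B \in indep ->
    (#|A| < #|B|)%N -> exists2 x, x \in B :\: A & x |: A \in indep
}.

Section Matroids.
Variables (T : finType) (M : matroid T).

Definition dependent (S : {set T}) : bool := S \notin indep M.

Definition mrank : nat := \max_(S in indep M) #|S|.

Definition loop (x : T) : bool := dependent [set x].

Definition parallel (x y : T) : bool :=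
  [&& ~~ loop x, ~~ loop y & dependent [set x; y]].

Definition simple_matroid : Prop :=
  (forall x, ~~ loop x) /\ (forall x y, parallel x y -> x = y).

(* [f] chooses one element [f B] from each block [B] of the subfamily [Q]. *)
Definition indep_partition_at (p : nat) (P : {set {set T}}) : Prop :=
  forall (Q : {set {set T}}) (f : {set T} -> T),
    Q \subset P -> (#|Q| <= p)%N -> (forall B, B \in Q -> f B \in B) ->
    f @: Q \in indep M.

Definition indep_partition (P : {set {set T}}) : Prop :=
  indep_partition_at mrank.+1 P.

Definition indep_matroid_at (p : nat) : Prop :=
  forall P : {set {set T}}, partition P [set: T] ->
    indep_partition_at p P -> indep_partition P.

End Matroids.

(** * The exterior algebra on the free module with basis indexed by ['I_n] *)

(* An element is given by its coordinates in the basis of monomials [e_S]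
   ([ext_basis] below; [ext_monE] shows that [ext_basis S] is the increasing
   product of the generators).  The alias hides the pointwise product that
   finite functions carry. *)
Definition extalg (R : comNzRingType) (n : nat) : Type :=
  {ffun {set 'I_n} -> R^o}.

HB.instance Definition _ (R : comNzRingType) (n : nat) :=
  GRing.Lmodule.copy (extalg R n) {ffun {set 'I_n} -> R^o}.

Section Exterior.
Variables (R : comNzRingType) (n : nat).
Local Notation E := (extalg R n).
Implicit Types (S T U : {set 'I_n}) (x y z : E).

Definition ext_coef S x : R := (x : {ffun {set 'I_n} -> R^o}) S.

Definition ext_basis S : E := [ffun U => (U == S)%:R].

(* The number of pairs [(i, j)] in [S * T] that are out of order. *)
Definition ninv S T : nat := (\sum_(i in S) \sum_(j in T) (j < i))%N.

Definition ext_basis_mul S T : E :=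
  if [disjoint S & T] then (-1) ^+ ninv S T *: ext_basis (S :|: T) else 0.

Definition ext_mul x y : E :=
  \sum_S \sum_T (ext_coef S x * ext_coef T y) *: ext_basis_mul S T.

Lemma ext_coef_basis S U : ext_coef U (ext_basis S) = (U == S)%:R.
Proof. by rewrite /ext_coef ffunE. Qed.

Lemma ext_coefD S x y : ext_coef S (x + y) = ext_coef S x + ext_coef S y.
Proof. by rewrite /ext_coef ffunE. Qed.

Lemma ext_coefZ S a x : ext_coef S (a *: x) = a * ext_coef S x.
Proof. by rewrite /ext_coef ffunE. Qed.

Lemma ext_coef_sum (I : Type) (r : seq I) (P : pred I) (F : I -> E) S :
  ext_coef S (\sum_(i <- r | P i) F i) = \sum_(i <- r | P i) ext_coef S (F i).
Proof.
by apply: (big_morph (ext_coef S)) => [u v|]; rewrite ?ext_coefD // /ext_coef ffunE.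
Qed.

Lemma ext_coefP x y : (forall S, ext_coef S x = ext_coef S y) -> x = y.
Proof. by move=> eqxy; apply/ffunP. Qed.

Lemma ext_expand x : x = \sum_S ext_coef S x *: ext_basis S.
Proof.
apply: ext_coefP => U; rewrite ext_coef_sum (bigD1 U) //= big1 => [|S neSU].
  by rewrite addr0 ext_coefZ ext_coef_basis eqxx mulr1.
by rewrite ext_coefZ ext_coef_basis eq_sym (negPf neSU) mulr0.
Qed.

Fact ext_mulDl : left_distributive ext_mul +%R.
Proof.
move=> x y z; rewrite /ext_mul -big_split; apply: eq_bigr => S _.
rewrite -big_split; apply: eq_bigr => T _ /=.
by rewrite ext_coefD mulrDl scalerDl.
Qed.

Fact ext_mulDr : right_distributive ext_mul +%R.
Proof.
move=> x y z; rewrite /ext_mul -big_split; apply: eq_bigr => S _.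
rewrite -big_split; apply: eq_bigr => T _ /=.
by rewrite ext_coefD mulrDr scalerDl.
Qed.

Fact ext_scaleAl a x y : a *: ext_mul x y = ext_mul (a *: x) y.
Proof.
rewrite /ext_mul scaler_sumr; apply: eq_bigr => S _.
rewrite scaler_sumr; apply: eq_bigr => T _ /=.
by rewrite ext_coefZ scalerA mulrA.
Qed.

Fact ext_scaleAr a x y : a *: ext_mul x y = ext_mul x (a *: y).
Proof.
rewrite /ext_mul scaler_sumr; apply: eq_bigr => S _.
rewrite scaler_sumr; apply: eq_bigr => T _ /=.
by rewrite ext_coefZ scalerA mulrCA.
Qed.

Fact ext_mul_suml (I : Type) (r : seq I) (F : I -> E) y :
  ext_mul (\sum_(i <- r) F i) y = \sum_(i <- r) ext_mul (F i) y.
Proof.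
apply: (big_morph (ext_mul^~ y)) => [u v|]; first exact: ext_mulDl.
by rewrite -[0 in LHS](scale0r (0 : E)) -ext_scaleAl scale0r.
Qed.

Fact ext_mul_sumr (I : Type) (r : seq I) (F : I -> E) x :
  ext_mul x (\sum_(i <- r) F i) = \sum_(i <- r) ext_mul x (F i).
Proof.
apply: (big_morph (ext_mul x)) => [u v|]; first exact: ext_mulDr.
by rewrite -[0 in LHS](scale0r (0 : E)) -ext_scaleAr scale0r.
Qed.

Fact ext_mul_basis S T :
  ext_mul (ext_basis S) (ext_basis T) = ext_basis_mul S T.
Proof.
rewrite /ext_mul (bigD1 S) //= [X in _ + X]big1 => [|U neU]; last first.
  by apply: big1 => V _; rewrite ext_coef_basis (negPf neU) mul0r scale0r.
rewrite addr0 (bigD1 T) //= big1 => [|U neU].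
  by rewrite !ext_coef_basis !eqxx mulr1 scale1r addr0.
by rewrite !ext_coef_basis (negPf neU) mulr0 scale0r.
Qed.

Lemma ninvUl S T U :
  [disjoint S & T] -> ninv (S :|: T) U = (ninv S U + ninv T U)%N.
Proof.
by move=> dST; rewrite /ninv -bigU //; apply: eq_bigl => i; rewrite !inE.
Qed.

Lemma ninvUr S T U :
  [disjoint T & U] -> ninv S (T :|: U) = (ninv S T + ninv S U)%N.
Proof.
move=> dTU; rewrite /ninv -big_split; apply: eq_bigr => i _ /=.
by rewrite -bigU //; apply: eq_bigl => j; rewrite !inE.
Qed.

Lemma ninv0l S : ninv set0 S = 0%N.
Proof. by rewrite /ninv big_set0. Qed.

Lemma ninv0r S : ninv S set0 = 0%N.
Proof. by rewrite /ninv big1 // => i _; rewrite big_set0. Qed.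

Fact ext_basis_mulA S T U :
  ext_mul (ext_basis S) (ext_basis_mul T U) =
  ext_mul (ext_basis_mul S T) (ext_basis U).
Proof.
have ext0l y : ext_mul 0 y = 0.
  by rewrite -[0 in LHS](scale0r (0 : E)) -ext_scaleAl scale0r.
have ext0r y : ext_mul y 0 = 0.
  by rewrite -[0 in LHS](scale0r (0 : E)) -ext_scaleAr scale0r.
have dUl (A B C : {set 'I_n}) :
    [disjoint A :|: B & C] = [disjoint A & C] && [disjoint B & C].
  by rewrite -!setI_eq0 setIUl setU_eq0.
have dUr (A B C : {set 'I_n}) :
    [disjoint A & B :|: C] = [disjoint A & B] && [disjoint A & C].
  by rewrite -!setI_eq0 setIUr setU_eq0.
rewrite /ext_basis_mul; case: ifP => dTU; case: ifP => dST.
- rewrite -ext_scaleAl -ext_scaleAr !ext_mul_basis /ext_basis_mul dUl dUr dST dTU.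
  rewrite andbT /=; case: ifP => dSU; last by rewrite !scaler0.
  rewrite !scalerA -!exprD setUA ninvUl // ninvUr //.
  by congr (_ ^+ _ *: _); rewrite addnC -addnA.
- by rewrite -ext_scaleAr ext_mul_basis /ext_basis_mul dUr dST scaler0 ext0l.
- by rewrite -ext_scaleAl ext_mul_basis /ext_basis_mul dUl dTU andbF scaler0 ext0r.
- by rewrite ext0l ext0r.
Qed.

Fact ext_mulA : associative ext_mul.
Proof.
move=> x y z; rewrite [x]ext_expand (ext_mul_suml _ _ (ext_mul y z)).
rewrite (ext_mul_suml _ _ y) (ext_mul_suml _ _ z); apply: eq_bigr => S _.
rewrite -!ext_scaleAl; congr (_ *: _).
rewrite [y]ext_expand (ext_mul_suml _ _ z) !(ext_mul_sumr _ _ (ext_basis S)).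
rewrite (ext_mul_suml _ _ z); apply: eq_bigr => T _.
rewrite -!(ext_scaleAl, ext_scaleAr); congr (_ *: _).
rewrite [z]ext_expand (ext_mul_sumr _ _ (ext_basis T)).
rewrite !(ext_mul_sumr _ _ (ext_basis S)) (ext_mul_sumr _ _ (ext_mul _ _)).
apply: eq_bigr => U _; rewrite -!ext_scaleAr; congr (_ *: _).
by rewrite !ext_mul_basis ext_basis_mulA.
Qed.

Fact ext_mul1l : left_id (ext_basis set0) ext_mul.
Proof.
move=> x; rewrite [x]ext_expand ext_mul_sumr; apply: eq_bigr => S _.
rewrite -ext_scaleAr ext_mul_basis /ext_basis_mul ninv0l scale1r set0U.
by rewrite -setI_eq0 set0I eqxx.
Qed.

Fact ext_mul1r : right_id (ext_basis set0) ext_mul.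
Proof.
move=> x; rewrite [x]ext_expand ext_mul_suml; apply: eq_bigr => S _.
rewrite -ext_scaleAl ext_mul_basis /ext_basis_mul ninv0r scale1r setU0.
by rewrite -setI_eq0 setI0 eqxx.
Qed.

Fact ext_1neq0 : ext_basis set0 != 0.
Proof.
apply/eqP => /(congr1 (ext_coef set0)).
by rewrite ext_coef_basis eqxx /ext_coef ffunE => /eqP; rewrite oner_eq0.
Qed.

End Exterior.

HB.instance Definition _ (R : comNzRingType) (n : nat) :=
  GRing.Zmodule_isNzRing.Build (extalg R n) (@ext_mulA R n) (@ext_mul1l R n)
    (@ext_mul1r R n) (@ext_mulDl R n) (@ext_mulDr R n) (@ext_1neq0 R n).

HB.instance Definition _ (R : comNzRingType) (n : nat) :=
  GRing.Lmodule_isLalgebra.Build R (extalg R n) (@ext_scaleAl R n).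

HB.instance Definition _ (R : comNzRingType) (n : nat) :=
  GRing.Lalgebra_isAlgebra.Build R (extalg R n) (@ext_scaleAr R n).

Section Boundary.
Variables (R : comNzRingType) (n : nat).
Local Notation E := (extalg R n).
Implicit Types (S T U : {set 'I_n}) (x y z : E).

Definition ext_gen (i : 'I_n) : E := ext_basis R [set i].

(* [enum S] lists [S] in increasing order ([sorted_enum_ord]). *)
Definition ext_mon S : E := \prod_(i <- enum S) ext_gen i.

Lemma sorted_enum_ord S : sorted (fun i j : 'I_n => i < j)%N (enum S).
Proof.
rewrite /enum_mem; apply: sorted_filter; first by move=> ? ? ?; apply: ltn_trans.
rewrite -enumT -[sorted _ _]/(sorted (relpre val ltn) _) -sorted_map.
by rewrite val_enum_ord iota_ltn_sorted.
Qed.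

Definition ext_homog (p : nat) x : Prop :=
  forall S, ext_coef S x != 0 -> #|S| = p.

(* [ninv [set i] S] is the number of elements of [S] smaller than [i]. *)
Definition ext_bdry_basis S : E :=
  \sum_(i in S) (-1) ^+ ninv [set i] S *: ext_basis R (S :\ i).

(* This is the unique linear map with [ext_bdry (ext_gen i) = 1] that satisfies
   the signed Leibniz rule: see [ext_bdry_gen], [ext_bdry_mul] and
   [ext_bdry_unique]. *)
Definition ext_bdry x : E := \sum_S ext_coef S x *: ext_bdry_basis S.

Fact ext_bdry_is_linear : linear ext_bdry.
Proof.
move=> a x y; rewrite /ext_bdry scaler_sumr -big_split; apply: eq_bigr => S _ /=.
by rewrite ext_coefD ext_coefZ scalerDl scalerA.
Qed.

HB.instance Definition _ :=
  GRing.isLinear.Build R E E _ ext_bdry ext_bdry_is_linear.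

Lemma ext_bdryZ a x : ext_bdry (a *: x) = a *: ext_bdry x.
Proof. exact: linearZ. Qed.

Lemma ext_basisM S T : ext_basis R S * ext_basis R T = ext_basis_mul R S T.
Proof. exact: ext_mul_basis. Qed.

Lemma ext_basis0 : ext_basis R set0 = 1 :> E.
Proof. by []. Qed.

Lemma ninv1 (i : 'I_n) S : ninv [set i] S = (\sum_(j in S) (j < i))%N.
Proof. by rewrite /ninv big_set1. Qed.

Lemma ext_genM i S : i \notin S ->
  ext_gen i * ext_basis R S = (-1) ^+ ninv [set i] S *: ext_basis R (i |: S).
Proof. by move=> iNS; rewrite ext_basisM /ext_basis_mul disjoints1 iNS. Qed.

Lemma ext_genM0 i S : i \in S -> ext_gen i * ext_basis R S = 0.
Proof. by move=> iS; rewrite ext_basisM /ext_basis_mul disjoints1 iS. Qed.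

Lemma ext_gen_sqr i : ext_gen i * ext_gen i = 0.
Proof. by rewrite ext_genM0 ?set11. Qed.

Lemma ext_gen_anticomm i j : ext_gen i * ext_gen j = - (ext_gen j * ext_gen i).
Proof.
have [->|neij] := eqVneq i j; first by rewrite ext_gen_sqr oppr0.
rewrite !ext_genM ?inE // 1?eq_sym // !ninv1 !big_set1 setUC.
by case: ltngtP neij => // [_|_|/val_inj->]; rewrite ?eqxx // ?expr0 ?expr1 scaleN1r scale1r ?opprK.
Qed.

Lemma ext_monE S : ext_mon S = ext_basis R S.
Proof.
rewrite /ext_mon; move: (sorted_enum_ord S); rewrite -[in RHS](set_enum S); elim: (enum S) => [|i s IHs] srt.
  by rewrite big_nil; congr ext_basis; apply/setP=> j; rewrite !inE.
have /allP ltis : all (fun j : 'I_n => i < j)%N s.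
  by apply: order_path_min srt => ? ? ?; apply: ltn_trans.
rewrite big_cons IHs ?(path_sorted srt) // ext_genM.
  rewrite ninv1 big1 => [|j]; last by rewrite inE => /ltis; case: ltngtP.
  by rewrite scale1r set_cons.
by rewrite inE; apply/negP => /ltis; rewrite ltnn.
Qed.

Lemma ext_bdry_basisE S : ext_bdry (ext_basis R S) = ext_bdry_basis S.
Proof.
rewrite /ext_bdry (bigD1 S) //= big1 => [|U neU].
  by rewrite ext_coef_basis eqxx scale1r addr0.
by rewrite ext_coef_basis (negPf neU) scale0r.
Qed.

Lemma ext_bdry_gen i : ext_bdry (ext_gen i) = 1.
Proof.
rewrite ext_bdry_basisE /ext_bdry_basis big_set1 ninv1 big_set1 ltnn scale1r.
by rewrite setDv.
Qed.

Lemma ninvD1 i j S : i \in S ->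
  ninv [set j] S = ((i < j) + ninv [set j] (S :\ i))%N.
Proof. by move=> iS; rewrite !ninv1 (big_setD1 i). Qed.

Fact skew_mul_aux (A : algType R) (g b db z dz : A) k :
  b * z - g * (db * z + (-1) ^+ k *: (b * dz)) =
  (b - g * db) * z + (-1) ^+ k.+1 *: (g * b * dz).
Proof.
rewrite mulrBl mulrDr opprD addrA -mulrA exprS mulN1r scaleNr.
by rewrite -scalerAr mulrA.
Qed.

Fact sign_addnn k : (-1) ^+ (k + k) = 1 :> R.
Proof. by rewrite -signr_odd addnn odd_double. Qed.

Fact ext_bdry_genM i x : ext_bdry (ext_gen i * x) = x - ext_gen i * ext_bdry x.
Proof.
rewrite [x]ext_expand mulr_sumr !(raddf_sum ext_bdry) /= mulr_sumr -sumrB.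
apply: eq_bigr => S _; rewrite -scalerAr !ext_bdryZ -scalerAr -scalerBr.
congr (_ *: _); rewrite ext_bdry_basisE.
have [iS|iNS] := boolP (i \in S).
  rewrite ext_genM0 // linear0 /ext_bdry_basis (big_setD1 i) //= mulrDr.
  rewrite mulr_sumr big1 => [|j]; last first.
    rewrite !inE => /andP[neji jS]; rewrite -scalerAr ext_genM0 ?scaler0 //.
    by rewrite !inE eq_sym neji.
  rewrite addr0 -scalerAr ext_genM ?setD11 // setD1K // scalerA -exprD.
  rewrite {1}(ninvD1 i iS) ltnn add0n sign_addnn scale1r.
  by rewrite subrr.
rewrite ext_genM // ext_bdryZ ext_bdry_basisE /ext_bdry_basis big_setU1 //=.
rewrite scalerDr scalerA -exprD (ninvD1 i (setU11 i S)) ltnn setU1K // add0n.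
rewrite sign_addnn scale1r; congr (_ + _).
rewrite scaler_sumr mulr_sumr -sumrN; apply: eq_bigr => j jS.
have neij : i != j by apply: contraNneq iNS => ->.
rewrite -scalerAr ext_genM ?inE ?(negPf iNS) ?andbF // !scalerA -!exprD -scaleNr.
have -> : (i |: S) :\ j = i |: S :\ j.
  by apply/setP => k; rewrite !inE; case: (eqVneq k i) => [->|]; rewrite ?neij ?andbT.
congr (_ *: _); rewrite (ninvD1 i jS) (ninvD1 j (setU11 i S)) setU1K //.
rewrite -[RHS]mulN1r -exprS.
case: ltngtP neij => [_ _|_ _|/val_inj -> /eqP//] /=; congr (_ ^+ _).
  by rewrite !add0n; lia.
by lia.
Qed.

Lemma ext_bdry_mul p x y : ext_homog p x ->
  ext_bdry (x * y) = ext_bdry x * y + (-1) ^+ p *: (x * ext_bdry y).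
Proof.
have mulB S z : ext_bdry (ext_basis R S * z) =
    ext_bdry (ext_basis R S) * z + (-1) ^+ #|S| *: (ext_basis R S * ext_bdry z).
  have [m] := ubnP #|S|; elim: m => // m IHm in S z *; rewrite ltnS => leSm.
  have [->|/set0Pn[i iS]] := eqVneq S set0.
    rewrite cards0 scale1r ext_basis0 !mul1r.
    by rewrite -[1]ext_basis0 ext_bdry_basisE /ext_bdry_basis big_set0 mul0r add0r.
  have cardS := cardsD1 i S; rewrite iS add1n in cardS.
  have [c defS] : exists c : R,
      ext_basis R S = c *: (ext_gen i * ext_basis R (S :\ i)).
    exists ((-1) ^+ ninv [set i] (S :\ i)).
    by rewrite ext_genM ?setD11 // setD1K // scalerA -exprD sign_addnn scale1r.
  have mulGB : ext_bdry (ext_gen i * ext_basis R (S :\ i) * z) =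
      ext_bdry (ext_gen i * ext_basis R (S :\ i)) * z
      + (-1) ^+ #|S| *: (ext_gen i * ext_basis R (S :\ i) * ext_bdry z).
    have IHz := IHm (S :\ i) z; rewrite -cardS in IHz.
    rewrite -(mulrA (ext_gen i)) (ext_bdry_genM i (ext_basis R _ * z)).
    rewrite (IHz leSm) cardS skew_mul_aux; congr (_ * _ + _).
    by rewrite -ext_bdry_genM.
  rewrite defS -(scalerAl c) (ext_bdryZ c (_ * z)) mulGB (ext_bdryZ c).
  rewrite -(scalerAl c (ext_bdry _) z) -(scalerAl c _ (ext_bdry z)).
  by rewrite scalerDr !scalerA [c * _]mulrC.
move=> hx; rewrite [x]ext_expand [X in ext_bdry X = _]mulr_suml.
rewrite [X in _ *: X]mulr_suml !(raddf_sum ext_bdry) /=.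
rewrite [X in _ = X + _]mulr_suml scaler_sumr -big_split.
apply: eq_bigr => S _ /=; have [->|/hx <-] := eqVneq (ext_coef S x) 0.
  by rewrite scale0r !mul0r (linear0 ext_bdry) mul0r scaler0 addr0.
rewrite -(scalerAl _ _ y) -(scalerAl _ _ (ext_bdry y)) !ext_bdryZ mulB.
by rewrite -(scalerAl _ _ y) scalerDr !scalerA [_ * ext_coef S x]mulrC.
Qed.

Lemma ext_bdry_unique (d : {linear E -> E}) :
    (forall i, d (ext_gen i) = 1) ->
    (forall p x y, ext_homog p x -> d (x * y) = d x * y + (-1) ^+ p *: (x * d y)) ->
  d =1 ext_bdry.
Proof.
move=> d_gen d_mul x; rewrite [x]ext_expand (raddf_sum d) (raddf_sum ext_bdry) /=.
apply: eq_bigr => S _; rewrite ext_bdryZ linearZ /=; congr (_ *: _).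
have [m] := ubnP #|S|; elim: m => // m IHm in S *; rewrite ltnS => leSm.
have [->|/set0Pn[i iS]] := eqVneq S set0.
  rewrite ext_bdry_basisE /ext_bdry_basis big_set0 ext_basis0.
  have: d (1 * 1) = d 1 * 1 + (-1) ^+ 0 *: (1 * d 1).
    apply: d_mul => U; rewrite -ext_basis0 ext_coef_basis.
    by case: (U =P set0) => [->|]; rewrite ?cards0 ?eqxx.
  by rewrite !mul1r mulr1 scale1r => /eqP; rewrite -subr_eq0 opprD addNKr oppr_eq0 => /eqP.
have cardS := cardsD1 i S; rewrite iS add1n in cardS.
have -> : ext_basis R S =
    (-1) ^+ ninv [set i] (S :\ i) *: (ext_gen i * ext_basis R (S :\ i)).
  by rewrite ext_genM ?setD11 // setD1K // scalerA -exprD sign_addnn scale1r.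
rewrite linearZ ext_bdryZ /=; congr (_ *: _); rewrite ext_bdry_genM (d_mul 1%N).
  by rewrite d_gen mul1r expr1 scaleN1r IHm // -ltnS -cardS.
move=> U; rewrite ext_coef_basis.
by case: (U =P [set i]) => [->|]; rewrite ?cards1 ?eqxx.
Qed.

Definition ideal_closed (J : E -> Prop) : Prop :=
  [/\ J 0, forall x y, J x -> J y -> J (x + y)
    & forall a x b, J x -> J (a * x * b)].

Definition ideal_gen (X : E -> Prop) (x : E) : Prop :=
  forall J : E -> Prop, ideal_closed J -> (forall y, X y -> J y) -> J x.

Variable M : matroid 'I_n.

Definition os_ideal : E -> Prop :=
  ideal_gen (fun y => exists2 S, dependent M S & y = ext_bdry (ext_mon S)).

Definition os_quadratic : Prop :=
  forall x, os_ideal x <-> ideal_gen (fun y => os_ideal y /\ ext_homog 2 y) x.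

End Boundary.

Arguments os_ideal R {n} M x.
Arguments os_quadratic R {n} M.

(* Main.v *)
Require Import Defs.
From HB Require Import structures.
From mathcomp Require Import all_boot all_order all_algebra.

Set Implicit Arguments.
Unset Strict Implicit.
Unset Printing Implicit Defensive.

Import GRing.Theory.
Local Open Scope ring_scope.

(** Let [P] be a 3-independent partition and let [phi] be the endomorphism of the
    exterior algebra that identifies generators in the same block of [P].  It
    commutes with the boundary.  A dependent set of at most three elements meets
    some block twice, so [phi] kills its boundary, and hence the whole degree 2
    part of the Orlik-Solomon ideal.  If that part generates the ideal, then
    [phi] kills the boundary of every dependent set [S].  But [phi] is injective
    on the subalgebra of a transversal of [P], and the boundary of a nonempty
    monomial is nonzero, so no transversal is dependent. *)

(** * The universal property of the exterior algebra *)

Section ExtLift.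
Variables (R : comNzRingType) (n : nat) (A : algType R) (g : 'I_n -> A).
Hypothesis g_sqr : forall i, g i * g i = 0.
Hypothesis g_anticomm : forall i j, g i * g j = - (g j * g i).
Local Notation E := (extalg R n).
Local Notation e := (@ext_gen R n).
Local Notation ltI := (fun i j : 'I_n => i < j)%N.

Definition ext_lift (x : E) : A :=
  \sum_S ext_coef S x *: \prod_(i <- enum S) g i.

Fact ext_lift_is_linear : linear ext_lift.
Proof.
move=> a x y; rewrite /ext_lift scaler_sumr -big_split; apply: eq_bigr => S _ /=.
by rewrite ext_coefD ext_coefZ scalerDl scalerA.
Qed.

HB.instance Definition _ :=
  GRing.isLinear.Build R E A _ ext_lift ext_lift_is_linear.

Lemma ext_lift_basis S : ext_lift (ext_basis R S) = \prod_(i <- enum S) g i.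
Proof.
rewrite /ext_lift (bigD1 S) //= [X in _ + X]big1 => [|U neU].
  by rewrite ext_coef_basis eqxx scale1r addr0.
by rewrite ext_coef_basis (negPf neU) scale0r.
Qed.

Lemma ext_lift_sorted (s : seq 'I_n) : sorted ltI s ->
  ext_lift (\prod_(i <- s) e i) = \prod_(i <- s) g i.
Proof.
move=> srt; have enum_s : enum [set i in s] = s.
  apply: (@irr_sorted_eq _ ltI) => // [? ? ?|?||i]; rewrite ?ltnn //.
  - exact: ltn_trans.
  - exact: sorted_enum_ord.
  - by rewrite mem_enum inE.
by rewrite -[in RHS]enum_s -ext_lift_basis -ext_monE /ext_mon enum_s.
Qed.

(* The same relations straighten a word in the generators of [E] and its image. *)
Lemma ext_straighten (i : 'I_n) (s : seq 'I_n) : sorted ltI s ->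
  exists (a : R) (t : seq 'I_n), [/\ sorted ltI t, {subset t <= i :: s},
    e i * \prod_(j <- s) e j = a *: \prod_(j <- t) e j
    & g i * \prod_(j <- s) g j = a *: \prod_(j <- t) g j].
Proof.
elim: s => [|j s IHs] srt.
  by exists 1, [:: i]; split=> //; rewrite !scale1r !big_seq1 !big_nil !mulr1.
have [ltij|ltji|/val_inj<-] := ltngtP i j.
- by exists 1, [:: i, j & s]; split=> //=; rewrite ?ltij // !scale1r [RHS]big_cons.
- have [a [t [srt_t sub_t De Dg]]] := IHs (path_sorted srt).
  exists (- a), (j :: t); split.
  + rewrite /= path_min_sorted //; apply/allP => k /sub_t; rewrite inE.
    case/predU1P=> [->//|]; apply: (allP (order_path_min _ srt)).
    by move=> ? ? ?; apply: ltn_trans.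
  + move=> k; rewrite !inE => /predU1P[->|/sub_t]; first by rewrite eqxx orbT.
    by rewrite inE => /orP[->//|->]; rewrite !orbT.
  + by rewrite !big_cons mulrA ext_gen_anticomm mulNr -mulrA De -scalerAr scaleNr.
  + by rewrite !big_cons mulrA g_anticomm mulNr -mulrA Dg -scalerAr scaleNr.
- exists 0, [::]; split=> //; rewrite !scale0r big_cons mulrA.
    by rewrite ext_gen_sqr mul0r.
  by rewrite g_sqr mul0r.
Qed.

(** Straightening [e i] times an increasing monomial and straightening its image give the same
    scalar and the same increasing word, and on increasing words the lift is known. *)
Lemma ext_lift_genM i x : ext_lift (e i * x) = g i * ext_lift x.
Proof.
rewrite [x]ext_expand mulr_sumr !linear_sum mulr_sumr; apply: eq_bigr => S _ /=.
rewrite -scalerAr !linearZ -scalerAr /=; congr (_ *: _).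
have [a [t [srt_t _ De Dg]]] := ext_straighten i (sorted_enum_ord S).
by rewrite ext_lift_basis Dg -ext_monE /ext_mon De linearZ /= ext_lift_sorted.
Qed.

Lemma ext_liftM x y : ext_lift (x * y) = ext_lift x * ext_lift y.
Proof.
rewrite [x]ext_expand mulr_suml !linear_sum mulr_suml; apply: eq_bigr => S _ /=.
rewrite -scalerAl !linearZ -scalerAl /=; congr (_ *: _).
rewrite ext_lift_basis -ext_monE /ext_mon.
elim: (enum S) => [|i s IHs]; first by rewrite !big_nil !mul1r.
by rewrite !big_cons -!mulrA ext_lift_genM IHs.
Qed.

End ExtLift.

(** * Supports of products and nonvanishing of boundaries *)

Section ExtCoef.
Variables (R : comNzRingType) (n : nat).
Local Notation E := (extalg R n).
Implicit Types (S T U : {set 'I_n}) (x y : E).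

Lemma ext_coefM_neq0 U x y : ext_coef U (x * y) != 0 ->
  exists S T, [/\ [disjoint S & T], U = S :|: T, ext_coef S x != 0
                & ext_coef T y != 0].
Proof.
pose ST_ok S T := [&& [disjoint S & T], U == S :|: T, ext_coef S x != 0
                    & ext_coef T y != 0].
have [[S T]|no_ST] := pickP (fun u => ST_ok u.1 u.2).
  by case/and4P=> ? /eqP ? ? ? _; exists S, T.
case/eqP; rewrite -[x * y]/(ext_mul x y) ext_coef_sum big1 // => S _.
rewrite ext_coef_sum big1 // => T _; rewrite ext_coefZ.
have /negbT := no_ST (S, T); rewrite /ST_ok /= !negb_and !negbK /ext_basis_mul.
case: ifP => [_ /=|_ _]; last by rewrite [ext_coef U 0]ffunE mulr0.
rewrite ext_coefZ ext_coef_basis.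
by case/or3P=> [/negPf->|/eqP->|/eqP->]; rewrite !(mulr0, mul0r).
Qed.

(** Recording only the support avoids computing the sign of the sorting permutation. *)
Lemma ext_coef_prod_gen (s : seq 'I_n) U :
  ext_coef U (\prod_(i <- s) ext_gen R i) != 0 -> uniq s /\ U = [set i in s].
Proof.
elim: s => [|i s IHs] in U *.
  rewrite big_nil -ext_basis0 ext_coef_basis; case: (U =P set0) => [->|];
    last by rewrite eqxx.
  by split=> //; apply/setP => j; rewrite !inE.
rewrite big_cons => /ext_coefM_neq0[S [T [dST -> Si /IHs[uniq_s DT]]]].
have DS : S = [set i].
  by apply: contraNeq Si => /negPf neS; rewrite ext_coef_basis neS.
move: dST; rewrite DS DT disjoints1 inE => isN.
by split; rewrite /= ?isN //; apply/setP => j; rewrite !inE.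
Qed.

(** For [i] in [S], [e_i e_S = 0], so the Leibniz rule gives [e_i ∂e_S = e_S], which is nonzero
    because [1 != 0] in [R]. *)
Lemma ext_bdry_basis_neq0 S : S != set0 -> ext_bdry (ext_basis R S) != 0.
Proof.
case/set0Pn=> i iS; apply/eqP => dS0.
have := ext_bdry_genM i (ext_basis R S).
rewrite dS0 mulr0 subr0 ext_genM0 // linear0 => /(congr1 (ext_coef S)).
by rewrite ext_coef_basis eqxx [LHS]ffunE => /eqP; rewrite eq_sym oner_eq0.
Qed.

End ExtCoef.

(** * Endomorphisms induced by relabelling the generators *)

Section ExtRelabel.
Variables (R : comNzRingType) (n : nat) (r : 'I_n -> 'I_n).
Local Notation E := (extalg R n).
Implicit Types (S T U : {set 'I_n}) (x y : E).

Definition ext_relabel : E -> E := ext_lift (fun i => ext_gen R (r i)).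

HB.instance Definition _ := GRing.Linear.copy ext_relabel
  (ext_lift (fun i => ext_gen R (r i))).

Lemma ext_relabelM x y : ext_relabel (x * y) = ext_relabel x * ext_relabel y.
Proof. by apply: ext_liftM => *; [apply: ext_gen_sqr|apply: ext_gen_anticomm]. Qed.

(** On monomials, peel off the first generator: both sides obey the same Leibniz recursion, since
    every generator, relabelled or not, has boundary 1. *)
Lemma ext_relabel_bdry x : ext_relabel (ext_bdry x) = ext_bdry (ext_relabel x).
Proof.
rewrite [x]ext_expand !linear_sum; apply: eq_bigr => S _ /=.
rewrite !linearZ /=; congr (_ *: _); rewrite -ext_bdry_basisE.
rewrite -ext_monE /ext_mon; have := sorted_enum_ord S.
elim: (enum S) => [_|i s IHs srt].
  by rewrite !big_nil -ext_basis0 ext_bdry_basisE /ext_bdry_basis big_set0 linear0.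
have srt_s := path_sorted srt.
have relabel_genM z :
    ext_relabel (ext_gen R i * z) = ext_gen R (r i) * ext_relabel z.
  by apply: ext_lift_genM => *; [apply: ext_gen_sqr|apply: ext_gen_anticomm].
rewrite !big_cons !ext_bdry_genM linearB /= relabel_genM IHs //.
by rewrite /ext_relabel ext_lift_sorted.
Qed.

(** Each [e_S] maps to plus or minus the monomial of [r @: S], or to 0 when [r] identifies two
    elements of [S]. *)
Lemma ext_coef_relabel U x : ext_coef U (ext_relabel x) != 0 ->
  exists S, [/\ ext_coef S x != 0, {in S &, injective r} & U = r @: S].
Proof.
move=> Ux; pose S_ok S := (ext_coef S x != 0) &&
  (ext_coef U (\prod_(i <- enum S) ext_gen R (r i)) != 0).
have [S /andP[Sx]|no_S] := pickP S_ok.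
  rewrite -(big_map r xpredT (@ext_gen R n)) => /ext_coef_prod_gen[uniq_rS ->].
  exists S; split=> //; first exact/dinjectiveP.
  by apply/setP => i; rewrite inE; apply/mapP/imsetP => -[j Sj ->];
    exists j; rewrite ?mem_enum // -mem_enum.
case/eqP: Ux; rewrite ext_coef_sum big1 // => S _; rewrite ext_coefZ.
by have /negbT := no_S S; rewrite negb_and !negbK => /orP[]/eqP->;
  rewrite ?mulr0 ?mul0r.
Qed.

Lemma ext_relabel_basis_id S : {in S, r =1 id} ->
  ext_relabel (ext_basis R S) = ext_basis R S.
Proof.
move=> rS; rewrite /ext_relabel ext_lift_basis -ext_monE; apply: eq_big_seq => i.
by rewrite mem_enum => /rS->.
Qed.

Lemma ext_relabel_ker_ideal : ideal_closed (fun x => ext_relabel x = 0).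
Proof.
split=> [|x y x0 y0|a x b x0]; first exact: linear0.
  by rewrite linearD /= x0 y0 addr0.
by rewrite !ext_relabelM x0 mulr0 mul0r.
Qed.

(** Multiplication only enlarges supports, so a lower bound on degrees in the image passes from
    generators to the whole ideal. *)
Lemma ext_relabel_deg_ideal k :
  ideal_closed (fun x => forall U, ext_coef U (ext_relabel x) != 0 -> (k <= #|U|)%N).
Proof.
split=> [U|x y hx hy U|a x b hx U].
- by rewrite linear0 [ext_coef _ _]ffunE eqxx.
- rewrite linearD ext_coefD /=; have [->|/hx//] := eqVneq (ext_coef U (ext_relabel x)) 0.
  by rewrite add0r => /hy.
rewrite !ext_relabelM => /ext_coefM_neq0[S [T [_ -> + _]]].
case/ext_coefM_neq0=> S1 [S2 [_ -> _ /hx leS2]].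
by apply: leq_trans leS2 (subset_leq_card _); rewrite -setUA subsetU // subsetUl orbT.
Qed.

End ExtRelabel.

(** If [r] were injective on [S], the elements of [S] would lie in distinct blocks, so [S] would be
    a choice from at most [p] blocks, hence independent. *)
Lemma dependent_set_meets_block (T : finType) (M : matroid T) p
    (P : {set {set T}}) (r : T -> T) (S : {set T}) :
    partition P [set: T] -> indep_partition_at M p P ->
    (forall x y, pblock P x = pblock P y -> r x = r y) ->
  (#|S| <= p)%N -> dependent M S -> ~ {in S &, injective r}.
Proof.
move=> /and3P[/eqP coverP trivP _] indP r_block leSp /negP depS r_inj.
have inP x : x \in cover P by rewrite coverP inE.
have [S0|[x0 _]] := set_0Vmem S; first by case: depS; rewrite S0 indep0.
(* The default [x0] is never reached on blocks that meet [S], and only those are chosen from. *)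
pose f B := odflt x0 [pick x in S :&: B].
have f_block x : x \in S -> f (pblock P x) \in S :&: pblock P x.
  move=> Sx; rewrite /f; case: pickP => [//|/(_ x)].
  by rewrite inE Sx mem_pblock inP.
case: depS; have: f @: (pblock P @: S) \in indep M.
  apply: indP => [||_ /imsetP[x /f_block + ->]]; last by rewrite inE => /andP[].
    by apply/subsetP => _ /imsetP[x _ ->]; apply: pblock_mem.
  exact: leq_trans (leq_imset_card _ _) leSp.
apply: indepS; apply/subsetP => x Sx.
apply/imsetP; exists (pblock P x); first exact: imset_f.
have := f_block x Sx; rewrite inE => /andP[Sf fx].
by apply: r_inj => //; apply: r_block; rewrite (same_pblock trivP fx).
Qed.

Theorem theorem4p3 (R : comNzRingType) (n l : nat) (M : matroid 'I_n)
    (M_simple : simple_matroid M) (M_rank : mrank M = l) (l_ge3 : (3 <= l)%N)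
    (M_quadratic : os_quadratic R M) :
  indep_matroid_at M 3.
Proof.
move=> P partP indP Q f sQP _ fQ; set S0 := f @: Q; apply/negPn/negP => depS0.
(* [f] is controlled only on [Q]; on the other blocks [r] has an arbitrary value, but still a
   constant one. *)
pose r x := f (pblock P x); pose phi := @ext_relabel R n r.
have r_id : {in S0, r =1 id}.
  move=> _ /imsetP[B QB ->]; rewrite /r; have /and3P[_ trivP _] := partP.
  by rewrite (def_pblock trivP (subsetP sQP _ QB) (fQ _ QB)).
have r_block x y : pblock P x = pblock P y -> r x = r y by rewrite /r => ->.
(* It suffices to test generators: [phi] kills those with [#|S| <= 3], and for larger [S] the
   boundary has degree at least 3, which [phi] preserves. *)
have phi_deg3 x : os_ideal R M x ->
    forall U, ext_coef U (phi x) != 0 -> (3 <= #|U|)%N.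
  move/(_ _ (ext_relabel_deg_ideal R r 3)); apply=> _ [S depS ->] U.
  have [leS3|gtS3] := leqP #|S| 3.
    have -> : ext_relabel r (ext_bdry (ext_mon R S)) = 0.
      rewrite ext_relabel_bdry ext_monE.
      suff -> : ext_relabel r (ext_basis R S) = 0 by rewrite linear0.
      apply: ext_coefP => V; rewrite [RHS]ffunE; apply/eqP/negPn/negP.
      case/ext_coef_relabel=> S' []; rewrite ext_coef_basis.
      case: (S' =P S) => [->|]; last by rewrite eqxx.
      by move=> _ /(dependent_set_meets_block partP indP r_block leS3 depS).
    by rewrite [ext_coef _ _]ffunE eqxx.
  case/ext_coef_relabel=> S' [dS' r_inj ->]; rewrite card_in_imset // -ltnS.
  apply: leq_trans gtS3 _; apply: contraNleq dS' => ltS'.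
  rewrite ext_monE ext_bdry_basisE ext_coef_sum big1 // => i Si.
  rewrite ext_coefZ ext_coef_basis; case: eqP => [DS'|]; last by rewrite mulr0.
  by move: ltS'; rewrite DS' (cardsD1 i S) Si ltnn.
(* Terms of [phi x] have degree 2 since [phi] preserves degree, but [phi_deg3] allows only degrees
   at least 3. *)
have phi_quad x : os_ideal R M x -> ext_homog 2 x -> phi x = 0.
  move=> Ix hx; apply: ext_coefP => U; rewrite [RHS]ffunE.
  apply/eqP/negPn/negP => Ux; have := phi_deg3 x Ix U Ux.
  have [S [/hx cardS r_inj ->]] := ext_coef_relabel Ux.
  by rewrite card_in_imset // cardS.
have: phi (ext_bdry (ext_mon R S0)) = 0.
  have /M_quadratic/(_ _ (ext_relabel_ker_ideal R r)) :
      os_ideal R M (ext_bdry (ext_mon R S0)) by move=> J _; apply; exists S0.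
  by apply=> y [Iy hy]; apply: phi_quad.
(* [r] fixes [S0] pointwise, so the boundary of its monomial would vanish; [S0] is nonempty because
   the empty set is independent. *)
rewrite ext_monE /phi ext_relabel_bdry ext_relabel_basis_id //.
apply/eqP/ext_bdry_basis_neq0; apply: contraNneq depS0 => ->; exact: indep0.
Qed.
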